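(* For all $n\ge 1$, $$I_n(-1,t)=\sum_{\sigma\in\mathrm{Av}_n(321)}(-1)^{\mathrm{inv}\,\sigma}t^{\mathrm{lrm}\,\sigma}=\sum_{k=1}^{n}(-1)^{n-k}s_{n,k}\,t^k,$$ where $s_{n,k}$ is defined for $n\ge k\ge 1$ by $$s_{n,k}=\binom{\left\lfloor\frac{n-1}{2}\right\rfloor}{\left\lfloor\frac{k-1}{2}\right\rfloor}\binom{\left\lceil\frac{n-1}{2}\right\rceil}{\left\lceil\frac{k-1}{2}\right\rceil}.$$ Moreover, for all $n\ge 1$, $$I_{2n}(-1,t)=(t-1)\,I_{2n-1}(-1,t),$$ $$(n+1)\,I_{2n+1}(-1,t)=2\big((1+t^2)n-t\big)I_{2n-1}(-1,t)-(1-t^2)^2(n-1)\,I_{2n-3}(-1,t),$$ where for $n=1$ the last term, whose coefficient contains the factor $n-1=0$, is read as $0$.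
   Context: Let $\mathfrak S_n$ be the symmetric group of permutations $\sigma=b_1\ldots b_n$ (in one-line notation) of $[n]=\{1,\ldots,n\}$. Let $\mathrm{Av}_n(321)$ be the set of $\sigma=b_1\ldots b_n\in\mathfrak S_n$ avoiding the pattern $321$, i.e. such that there are no indices $i<j<l$ with $b_i>b_j>b_l$. For $\sigma=b_1\ldots b_n$ define the inversion number $\mathrm{inv}\,\sigma=\#\{(i,j)\mid i<j \text{ and } b_i>b_j\}$ and the number of left-right maxima $\mathrm{lrm}\,\sigma=\#\{i\mid b_i>b_j\text{ for all } j<i\}$ (so $i=1$ is always counted when $n\ge1$). The inversion number polynomial is $I_n(q,t)=\sum_{\sigma\in\mathrm{Av}_n(321)}q^{\mathrm{inv}\,\sigma}t^{\mathrm{lrm}\,\sigma}$, and $I_n(-1,t)$ is its specialization at $q=-1$, a polynomial in $t$. *)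

(* Defs.v *)
From mathcomp Require Import all_boot all_order all_fingroup all_algebra.

Set Implicit Arguments.
Unset Strict Implicit.
Unset Printing Implicit Defensive.

Import GRing.Theory.

(* A permutation of [n] is an element of 'S_n, i.e. of {0, ..., n-1}; the shift
   of indices and values by one does not affect the notions below. *)

Definition avoids321 (n : nat) (s : 'S_n) : bool :=
  ~~ [exists i : 'I_n, exists j : 'I_n, exists l : 'I_n,
       [&& i < j, j < l, s j < s i & s l < s j]].

Definition ninv (n : nat) (s : 'S_n) : nat :=
  #|[set p : 'I_n * 'I_n | (p.1 < p.2) && (s p.2 < s p.1)]|.

Definition nlrm (n : nat) (s : 'S_n) : nat :=
  #|[set i : 'I_n | [forall j : 'I_n, (j < i) ==> (s j < s i)]]|.

Definition snk (n k : nat) : nat :=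
  'C((n - 1)./2, (k - 1)./2) * 'C(uphalf (n - 1), uphalf (k - 1)).

Local Open Scope ring_scope.

(* I_n(q,t) as a polynomial in q (outer variable) with coefficients in Z[t]
   (inner variable): I_n(-1,t) is then (invpoly n).[-1] : {poly int}. *)
Definition invpoly (n : nat) : {poly {poly int}} :=
  \sum_(s : 'S_n | avoids321 s) 'X^(ninv s) * ('X^(nlrm s))%:P.

(* Main.v *)
(* Build a 321-avoiding permutation from left to right, each new last letter
   pushing up the values that are at least as large.  Only the gap d between the
   length n and the largest bottom of an inversion matters: the new letter is
   either the maximum (gap d + 1, weight t) or creates a gap e with
   1 <= e <= d and adds e inversions (weight q^e).  Hence I_n(q, t) is the value
   at gap 0 of the n-th iterate of the corresponding operator applied to 1.  At
   q = -1 the iterates have a closed form: with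
     F_m(c) = sum_k C(m, k) t^(2k) (C(m+c, c+k) - t C(m+c, c+k+1)),
   the 2m-th iterate equals F_m(c) at gaps 2c+1 and 2c+2, which is a consequence
   of Pascal's rule.  So I_(2m+1)(-1, t) = t F_m(0) and
   I_(2m+2)(-1, t) = t (t-1) F_m(0).  The three-term recurrence follows from a
   first-order recurrence for the pair sum_k C(m, k)^2 x^k and
   sum_k C(m, k) C(m, k+1) x^k. *)
Require Import Defs.
From mathcomp Require Import all_boot all_order all_fingroup all_algebra.
From mathcomp Require Import ring zify.
Set Implicit Arguments.
Unset Strict Implicit.
Unset Printing Implicit Defensive.

Import GRing.Theory.
Local Open Scope ring_scope.

(** * Inversion bottoms and 321-avoidance *)

(* With values counted from 0, the gap of s is n - inv_bound s. *)
Definition inv_bound n (s : 'S_n) : nat :=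
  \max_(p : 'I_n * 'I_n | (p.1 < p.2)%N && (s p.2 < s p.1)%N) (s p.2).+1.

Lemma inv_boundP n (s : 'S_n) (m : nat) :
  reflect (forall i j : 'I_n, (i < j)%N -> (s j < s i)%N -> (s j < m)%N)
    (inv_bound s <= m)%N.
Proof.
apply: (iffP idP) => [/bigmax_leqP H i j ij sji|H].
  by apply: (H (i, j)); rewrite /= ij.
by apply/bigmax_leqP => -[i j] /andP[/= ij sji]; apply: H sji.
Qed.

Lemma inv_bound_le n (s : 'S_n) : (inv_bound s <= n)%N.
Proof. by apply/inv_boundP => i j _ _; apply: ltn_ord. Qed.

Lemma avoids321P n (s : 'S_n) :
  reflect (forall i j l : 'I_n, (i < j)%N -> (j < l)%N -> (s j < s i)%N ->
             (s j <= s l)%N)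
    (avoids321 s).
Proof.
apply: (iffP idP) => [H i j l ij jl sji|H].
  rewrite leqNgt; apply: contra H => slj.
  by apply/existsP; exists i; apply/existsP; exists j; apply/existsP; exists l;
    rewrite ij jl sji.
apply/negP => /existsP[i /existsP[j /existsP[l /and4P[ij jl sji]]]].
by rewrite ltnNge (H i j l).
Qed.

(** * Effect of appending a last letter on the statistics *)

Lemma liftE n (v : 'I_n.+1) (a : 'I_n) : lift v a = (a + (v <= a))%N :> nat.
Proof. by rewrite /= /bump addnC. Qed.

Lemma lift_ltn n (v : 'I_n.+1) (a b : 'I_n) : (lift v a < lift v b)%N = (a < b)%N.
Proof. rewrite !liftE; lia. Qed.

Lemma big_ord_lift_max n (F : 'I_n.+1 -> nat) :
  (\sum_(i < n.+1) F i = \sum_(i < n) F (lift ord_max i) + F ord_max)%N.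
Proof.
rewrite big_ord_recr /=; congr addn; apply: eq_bigr => i _; congr F.
by apply: val_inj; rewrite /= /bump leqNgt ltn_ord.
Qed.

Definition append_value n (v : 'I_n.+1) (s : 'S_n) : 'S_n.+1 := lift_perm ord_max v s.

Lemma append_value_max n (v : 'I_n.+1) (s : 'S_n) : append_value v s ord_max = v.
Proof. exact: lift_perm_id. Qed.

Lemma append_value_lift n (v : 'I_n.+1) (s : 'S_n) i :
  append_value v s (lift ord_max i) = lift v (s i).
Proof. exact: lift_perm_lift. Qed.

Lemma append_value_bij n : bijective (fun p => @append_value n p.1 p.2).
Proof.
apply: inj_card_bij => [[v s] [w u] /= e|].
  have vw : v = w by rewrite -(append_value_max v s) e append_value_max.
  subst w; congr (_, _); apply/permP => i; apply: (@lift_inj _ v).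
  by rewrite -!append_value_lift e.
by rewrite card_prod card_ord !card_Sn factS.
Qed.

(** The last letter can only be the smallest letter of a 321, and it is one exactly when some
    inversion bottom of [s] is at least [v], hence ends up above [v] after the shift. *)
Lemma avoids321_append n (v : 'I_n.+1) (s : 'S_n) :
  avoids321 (append_value v s) = avoids321 s && (inv_bound s <= v)%N.
Proof.
apply/avoids321P/andP => [H|[/avoids321P Hs /inv_boundP Hb] i j l].
  split; first apply/avoids321P => i j l ij jl sji.
    have := H (lift ord_max i) (lift ord_max j) (lift ord_max l).
    rewrite !lift_max !append_value_lift lift_ltn => /(_ ij jl sji).
    by rewrite leqNgt lift_ltn -leqNgt.
  apply/inv_boundP => i j ij sji.
  have := H (lift ord_max i) (lift ord_max j) ord_max.
  rewrite !lift_max !append_value_lift lift_ltn append_value_max.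
  by move=> /(_ ij (ltn_ord j) sji); rewrite liftE; lia.
case: (unliftP ord_max i) => [i' ->|->]; last first.
  by rewrite ltnNge leq_ord.
case: (unliftP ord_max j) => [j' ->|-> _]; last first.
  by rewrite ltnNge leq_ord.
rewrite !append_value_lift !lift_ltn !lift_max.
case: (unliftP ord_max l) => [l' ->|->] ij jl sji.
  rewrite append_value_lift leqNgt lift_ltn -leqNgt.
  by apply: Hs ij _ sji; rewrite lift_max in jl.
by rewrite append_value_max liftE; have := Hb _ _ ij sji; lia.
Qed.

(** A maximal last letter creates no inversion. Any other one is itself an inversion bottom, and the
    old bottoms lie below it, unshifted. *)
Lemma inv_bound_append n (v : 'I_n.+1) (s : 'S_n) : (inv_bound s <= v)%N ->
  inv_bound (append_value v s) = if v == ord_max then inv_bound s else v.+1.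
Proof.
move=> sv; apply/eqP; rewrite eqn_leq; apply/andP; split.
  apply/inv_boundP => i j.
  case: (unliftP ord_max i) => [i' ->|->]; last by rewrite ltnNge leq_ord.
  rewrite append_value_lift lift_max.
  case: (unliftP ord_max j) => [j' ->|->].
    rewrite append_value_lift lift_max lift_ltn => ij sji.
    have /inv_boundP/(_ _ _ ij sji) := leqnn (inv_bound s).
    by rewrite liftE; case: ifP => _; lia.
  rewrite append_value_max liftE /=.
  by case: eqP => [-> _|//] /=; have := ltn_ord (s i'); lia.
case: eqP => [->|/eqP v_neq].
  apply/inv_boundP => i j ij sji.
  have /inv_boundP/(_ (lift ord_max i) (lift ord_max j)) :=
    leqnn (inv_bound (append_value ord_max s)).
  by rewrite !append_value_lift lift_ltn !lift_max; apply.
have v_lt : (v < n)%N.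
  by rewrite ltn_neqAle leq_ord andbT; apply: contra v_neq => /eqP e; apply/eqP/val_inj.
have /inv_boundP := leqnn (inv_bound (append_value v s)).
(* The letter of [s] with value [v] is shifted to [v + 1], so it forms an inversion with the new
   last letter. *)
pose i := (s^-1)%g (Ordinal v_lt).
move=> /(_ (lift ord_max i) ord_max).
rewrite append_value_lift append_value_max lift_max liftE permKV /= leqnn addn1.
by apply; rewrite ?ltn_ord.
Qed.

Lemma ninvE n (s : 'S_n) :
  ninv s = (\sum_(i < n) \sum_(j < n) ((i < j) && (s j < s i)))%N.
Proof.
rewrite /ninv -sum1_card big_mkcond pair_big /=; apply: eq_bigr => p _.
by rewrite inE; case: (_ && _).
Qed.

Lemma sum_leq_ord n v : (\sum_(i < n) (v <= i) = n - v)%N.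
Proof.
by elim: n => [|n IHn]; rewrite ?big_ord0 // big_ord_recr /= IHn; lia.
Qed.

Lemma ninv_append n (v : 'I_n.+1) (s : 'S_n) :
  ninv (append_value v s) = (ninv s + (n - v))%N.
Proof.
rewrite !ninvE big_ord_lift_max [X in (_ + X)%N]big1 ?addn0; last first.
  by move=> j _; rewrite ltnNge leq_ord.
(* The new inversions come from the old letters of value at least [v]; reindexing by [s] counts them
   by position. *)
rewrite -sum_leq_ord [X in _ = (_ + X)%N](reindex_perm s) -big_split; apply: eq_bigr => i _.
rewrite big_ord_lift_max append_value_lift append_value_max lift_max ltn_ord.
congr addn; last first.
  by rewrite liftE /=; congr nat_of_bool; apply/idP/idP; lia.
by apply: eq_bigr => j _; rewrite append_value_lift lift_ltn !lift_max.
Qed.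

Lemma nlrmE n (s : 'S_n) :
  nlrm s = (\sum_(i < n) [forall j : 'I_n, (j < i) ==> (s j < s i)])%N.
Proof.
rewrite /nlrm -sum1_card big_mkcond; apply: eq_bigr => i _.
by rewrite inE; case: [forall _, _].
Qed.

Lemma nlrm_append n (v : 'I_n.+1) (s : 'S_n) :
  nlrm (append_value v s) = (nlrm s + (v == ord_max))%N.
Proof.
rewrite !nlrmE big_ord_lift_max; congr addn.
  apply: eq_bigr => i _; congr nat_of_bool; apply/forallP/forallP => H j.
    by have := H (lift ord_max j); rewrite !append_value_lift !lift_ltn.
  apply/implyP; case: (unliftP ord_max j) => [j' ->|->]; last first.
    by rewrite lift_max ltnNge ltnW.
  by rewrite !append_value_lift !lift_ltn; apply/implyP.
congr nat_of_bool; rewrite append_value_max; apply/forallP/eqP => [H|-> j].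
  apply/eqP/negPn/negP => v_neq.
  have v_lt : (v < n)%N.
    rewrite ltn_neqAle leq_ord andbT.
    by apply: contra v_neq => /eqP e; apply/eqP/val_inj.
  (* The old letter [v], shifted to [v + 1], prevents the last letter from being a left-right
     maximum. *)
  have := H (lift ord_max ((s^-1)%g (Ordinal v_lt))).
  by rewrite append_value_lift permKV lift_max ltn_ord liftE /= leqnn; lia.
apply/implyP; case: (unliftP ord_max j) => [j' ->|->]; last by rewrite ltnn.
by rewrite append_value_lift !lift_max.
Qed.

(** * The transfer operator at q = -1 *)

Definition step (R : comNzRingType) (t : R) (g : nat -> R) (d : nat) : R :=
  t * g d.+1 + \sum_(e < d) (-1) ^+ e.+1 * g e.+1.

(** The test function [g] of the gap makes induction on [n] possible: summing over the last letter
    replaces [g] by [step t g]. The signed sum is the case [g = 1]. *)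
Definition weighted_sum (R : comNzRingType) (t : R) (n : nat) (g : nat -> R) : R :=
  \sum_(s : 'S_n | avoids321 s)
    (-1) ^+ ninv s * t ^+ nlrm s * g (n - inv_bound s)%N.

Lemma weighted_sum0 (R : comNzRingType) (t : R) g : weighted_sum t 0 g = g 0%N.
Proof.
rewrite /weighted_sum (big_pred1 1%g) => [|s].
  by rewrite ninvE nlrmE !big_ord0 !expr0 !mul1r.
have -> : s = 1%g by apply/permP; case.
by rewrite /= eqxx; apply/avoids321P; case.
Qed.

Lemma weighted_sumS (R : comNzRingType) (t : R) n g :
  weighted_sum t n.+1 g = weighted_sum t n (step t g).
Proof.
rewrite /weighted_sum (reindex _ (onW_bij _ (append_value_bij n))) /=.
rewrite -(pair_big_dep predT (fun v s => avoids321 (append_value v s))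
  (fun v s => (-1) ^+ ninv (append_value v s) * t ^+ nlrm (append_value v s) *
     g (n.+1 - inv_bound (append_value v s))%N)) /=.
rewrite (exchange_big_dep (fun s : 'S_n => avoids321 s)) /=; last first.
  by move=> v s _; rewrite avoids321_append => /andP[].
apply: eq_bigr => s s_av.
under eq_bigl => v do rewrite avoids321_append s_av /=.
have := inv_bound_le s; set b := inv_bound s => b_le.
under eq_bigr => v v_ge.
  rewrite ninv_append nlrm_append inv_bound_append // exprD (exprD t) -/b.
  over.
(* The maximal letter is split off: it raises the gap by one and gives the factor [t]. *)
rewrite big_mkcond big_ord_recr /= b_le eqxx subnn subSn // addrC.
rewrite [RHS]mulrDr; congr (_ + _); first by rewrite expr1; ring.
(* Set [v = n - (e + 1)]: such a letter adds [e + 1] inversions and leaves the gap [e + 1]. *)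
rewrite mulr_sumr (reindex_inj rev_ord_inj) /=.
rewrite (big_ord_widen n (fun e => (-1) ^+ ninv s * t ^+ nlrm s *
  ((-1) ^+ e.+1 * g e.+1)) (leq_subr b n)) [RHS]big_mkcond /=.
apply: eq_bigr => e _; have e_lt := ltn_ord e.
have -> : (b <= n - e.+1)%N = (e < n - b)%N by apply/idP/idP; lia.
case: ifP => // _.
have -> : (widen_ord (leqnSn n) (rev_ord e) == ord_max) = false.
  by apply/negP => /eqP/(congr1 val) /=; lia.
rewrite /= subSS subKn // expr0; ring.
Qed.

Lemma weighted_sum_iter (R : comNzRingType) (t : R) n g :
  weighted_sum t n g = iter n (step t) g 0%N.
Proof.
by elim: n g => [|n IHn] g; rewrite ?weighted_sum0 // weighted_sumS IHn -iterSr.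
Qed.

(** * Binomial convolutions and their recurrences *)

Definition binconv (R : comNzRingType) (x : R) (m p r : nat) : R :=
  \sum_(k < m.+1) ('C(m, k) * 'C(p, r + k))%:R * x ^+ k.

Lemma binconvSr (R : comNzRingType) (x : R) m p r :
  binconv x m p.+1 r.+1 = binconv x m p r.+1 + binconv x m p r.
Proof.
rewrite -big_split; apply: eq_bigr => k _ /=.
by rewrite addSn binS mulnDr natrD mulrDl.
Qed.

Lemma binconvSl (R : comNzRingType) (x : R) m p r :
  binconv x m.+1 p r = binconv x m p r + x * binconv x m p r.+1.
Proof.
rewrite /binconv big_ord_recl bin0.
under eq_bigr => k _ do rewrite lift0 binS mulnDl natrD mulrDl.
rewrite big_split /= addrA; congr (_ + _).
  by rewrite big_ord_recr /= (@bin_small m m.+1) // mul0n mul0r addr0 [RHS]big_ord_recl bin0.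
by rewrite mulr_sumr; apply: eq_bigr => k _; rewrite addnS exprS; ring.
Qed.

(** This is the boundary case [r = 0] of Pascal's rule in [p]: the term C(m, k) C(m, k-1) becomes
    C(m, k+1) C(m, k) after a shift of [k], whence the factor [x]. *)
Lemma binconv_sym (R : comNzRingType) (x : R) m :
  binconv x m m.+1 0 = binconv x m m 0 + x * binconv x m m 1.
Proof.
rewrite /binconv big_ord_recl [X in _ = X + _]big_ord_recl !bin0 -addrA.
congr (_ + _).
rewrite [X in _ = _ + _ * X]big_ord_recr /= (@bin_small m m.+1) // muln0 mul0r addr0.
rewrite mulr_sumr -big_split; apply: eq_bigr => k _ /=.
by rewrite /bump /= add0n add1n binS exprS !natrM natrD; ring.
Qed.

Lemma binconv_diagS (R : comNzRingType) (x : R) m :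
  binconv x m.+1 m.+1 0 =
  (1 + x) * binconv x m m 0 + 2%:R * x * binconv x m m 1.
Proof. by rewrite binconvSl binconv_sym binconvSr; ring. Qed.

(** The bracket is the sum of C(m, k) C(m+2, k+1) x^k, and the sides agree termwise: (m+2) C(m+1, k)
    = (k+1) C(m+2, k+1) and (m+1) C(m, k) = (k+1) C(m+1, k+1). *)
Lemma binconv_subdiagS (R : comNzRingType) (x : R) m :
  m.+2%:R * binconv x m.+1 m.+1 1 =
  m.+1%:R * (2%:R * binconv x m m 0 + (1 + x) * binconv x m m 1).
Proof.
have -> : 2%:R * binconv x m m 0 + (1 + x) * binconv x m m 1 = binconv x m m.+2 1.
  by rewrite !binconvSr binconv_sym; ring.
rewrite /binconv big_ord_recr /= (@bin_small m.+1 m.+2) // muln0 mul0r addr0.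
rewrite !mulr_sumr; apply: eq_bigr => k _; rewrite !mulrA -!natrM add1n.
congr (_%:R * _).
by rewrite !mulnA (mul_bin_diag m.+2) mulnAC (mul_bin_diag m.+1) mulnAC.
Qed.

(** This is the closed form F_m(c). *)
Definition wpoly (R : comNzRingType) (t : R) (m c : nat) : R :=
  binconv (t ^+ 2) m (m + c) c - t * binconv (t ^+ 2) m (m + c) c.+1.

Lemma wpoly0 (R : comNzRingType) (t : R) c : wpoly t 0 c = 1.
Proof.
rewrite /wpoly /binconv !big_ord1 add0n !addn0 binn (@bin_small c c.+1) //.
by rewrite muln0 mul0r mulr0 subr0 expr0 mulr1.
Qed.

Lemma wpolySS (R : comNzRingType) (t : R) m c :
  wpoly t m.+1 c.+1 = wpoly t m.+1 c +
    t ^+ 2 * (wpoly t m c.+2 - wpoly t m c.+1) + wpoly t m c.+1.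
Proof. by rewrite /wpoly !addnS !addSn !binconvSl !binconvSr; ring. Qed.

Lemma wpolyS0 (R : comNzRingType) (t : R) m :
  wpoly t m.+1 0 = t * ((t - 1) * wpoly t m 0) +
    t ^+ 2 * (wpoly t m 1 - wpoly t m 0) + wpoly t m 0.
Proof.
by rewrite /wpoly !addn0 !addn1 !binconvSl !binconvSr binconv_sym; ring.
Qed.

Lemma wpoly0_recurrence (R : comNzRingType) (t : R) m :
  m.+3%:R * wpoly t m.+2 0 =
  2%:R * ((1 + t ^+ 2) * m.+2%:R - t) * wpoly t m.+1 0 -
  (1 - t ^+ 2) ^+ 2 * m.+1%:R * wpoly t m 0.
Proof.
have e1 := binconv_subdiagS (t ^+ 2) m.
have e2 := binconv_subdiagS (t ^+ 2) m.+1.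
rewrite /wpoly !addn0 (binconv_diagS _ m.+1) (binconv_diagS _ m) in e2 *.
have comb0 (a b c d k l : R) : a = b -> c = d -> k * (a - b) + l * (c - d) = 0.
  by move=> -> ->; ring.
(* The multiplier [- t] of [e2] eliminates the subdiagonal sum at [m + 2]; that of [e1] then
   eliminates the one at [m + 1]. *)
apply/eqP; rewrite -subr_eq0 -(comb0 _ _ _ _ (2%:R * t ^+ 2 + t * (1 + t ^+ 2)) (- t) e1 e2).
by apply/eqP; ring.
Qed.

(** * Closed form of the iterates *)

Lemma step0 (R : comNzRingType) (t : R) g : step t g 0 = t * g 1.
Proof. by rewrite /step big_ord0 addr0. Qed.

Lemma stepS (R : comNzRingType) (t : R) g d :
  step t g d.+1 = step t g d + t * (g d.+2 - g d.+1) + (-1) ^+ d.+1 * g d.+1.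
Proof. by rewrite /step big_ord_recr /=; ring. Qed.

Lemma signr_double (R : comNzRingType) c : (-1) ^+ c.*2 = 1 :> R.
Proof. by rewrite -signr_odd odd_double. Qed.

(** By [stepS], passing from gap 2c to 2c+1 subtracts F_m(c), as [g] agrees at 2c+1 and 2c+2; the
    next increment restores the form [t] F_m(c+1). *)
Lemma step_even (R : comNzRingType) (t : R) m g :
  (forall c, g c.*2.+1 = wpoly t m c) -> (forall c, g c.*2.+2 = wpoly t m c) ->
  forall c, step t g c.*2 = t * wpoly t m c /\
    step t g c.*2.+1 = (t - 1) * wpoly t m c.
Proof.
move=> g1 g2.
have even_odd c : step t g c.*2 = t * wpoly t m c ->
    step t g c.*2.+1 = (t - 1) * wpoly t m c.
  by move=> gc; rewrite stepS gc g1 g2 exprS signr_double; ring.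
elim=> [|c [_ IHc]]; last first.
  suff gc : step t g c.+1.*2 = t * wpoly t m c.+1 by split; last exact: even_odd.
  by rewrite doubleS stepS IHc -doubleS g1 g2 !exprS signr_double; ring.
suff gc : step t g 0 = t * wpoly t m 0 by split; last exact: (even_odd 0%N).
by rewrite step0 (g1 0%N).
Qed.

(** Gap 0 lies outside the pairs 2c+1, 2c+2. Its value is kept separately: it starts the induction
    on [c] and yields the iterates of even order. *)
Lemma step_odd (R : comNzRingType) (t : R) m g :
  (forall c, g c.*2 = t * wpoly t m c) ->
  (forall c, g c.*2.+1 = (t - 1) * wpoly t m c) ->
  [/\ step t g 0 = t * ((t - 1) * wpoly t m 0),
      forall c, step t g c.*2.+1 = wpoly t m.+1 c &
      forall c, step t g c.*2.+2 = wpoly t m.+1 c].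
Proof.
move=> g1 g2.
have e0 : step t g 0 = t * ((t - 1) * wpoly t m 0) by rewrite step0 (g2 0%N).
have odd_even c : step t g c.*2.+1 = wpoly t m.+1 c ->
    step t g c.*2.+2 = wpoly t m.+1 c.
  by move=> gc; rewrite stepS gc -!doubleS g1 g2 !exprS signr_double; ring.
have e1 c : step t g c.*2.+1 = wpoly t m.+1 c.
  elim: c => [|c /odd_even IHc].
    by rewrite stepS e0 (g1 1%N) (g2 0%N) wpolyS0 expr1; ring.
  rewrite stepS doubleS IHc wpolySS -!doubleS !g1 !g2 !exprS signr_double; ring.
by split=> // c; apply: odd_even.
Qed.

Lemma iter_step (R : comNzRingType) (t : R) m :
  iter m.*2.+1 (step t) (fun=> 1) 0%N = t * wpoly t m 0 /\
  iter m.*2.+2 (step t) (fun=> 1) 0%N = t * ((t - 1) * wpoly t m 0).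
Proof.
have [we wo] : (forall c, iter m.*2 (step t) (fun=> 1) c.*2.+1 = wpoly t m c) /\
    (forall c, iter m.*2 (step t) (fun=> 1) c.*2.+2 = wpoly t m c).
  elim: m => [|m [IH1 IH2]]; first by split=> c; rewrite wpoly0.
  have e := step_even IH1 IH2.
  by case: (step_odd (fun c => (e c).1) (fun c => (e c).2)).
have e := step_even we wo.
case: (step_odd (fun c => (e c).1) (fun c => (e c).2)) => e0 _ _.
by split; [exact: (e 0%N).1 | exact: e0].
Qed.

(** * The explicit coefficients *)

Lemma sum_double (V : nmodType) (F : nat -> V) m :
  \sum_(k < m.*2) F k = \sum_(j < m) (F j.*2 + F j.*2.+1).
Proof.
elim: m => [|m IHm]; first by rewrite !big_ord0.
by rewrite doubleS !big_ord_recr /= IHm addrA.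
Qed.

(** The terms k = 2j and k = 2j+1 give C(m, j) C(p, j) t^(2j) and -C(m, j) C(p, j+1) t^(2j+1). *)
Lemma alternating_binconv (R : comNzRingType) (t : R) m p :
  \sum_(k < m.+1.*2) (-1) ^+ k * ('C(m, k./2) * 'C(p, uphalf k))%:R * t ^+ k =
  binconv (t ^+ 2) m p 0 - t * binconv (t ^+ 2) m p 1.
Proof.
rewrite (sum_double (fun k => (-1) ^+ k * ('C(m, k./2) * 'C(p, uphalf k))%:R * t ^+ k)).
rewrite mulr_sumr -sumrB; apply: eq_bigr => j _.
rewrite uphalf_double /= uphalf_double doubleK ![_ ^+ _.*2.+1]exprS signr_double.
by rewrite add0n add1n -exprM mul2n; ring.
Qed.

Definition snk_poly (R : comNzRingType) (t : R) (n : nat) : R :=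
  \sum_(1 <= k < n.+1) (-1) ^+ (n - k) * (snk n k)%:R * t ^+ k.

Lemma signrB (R : comNzRingType) n k : (k <= n)%N ->
  (-1) ^+ (n - k) = (-1) ^+ n * (-1) ^+ k :> R.
Proof.
by move=> kn; rewrite -{2}(subnK kn) exprD -mulrA -exprD addnn signr_double mulr1.
Qed.

Lemma snk_polyE (R : comNzRingType) (t : R) n : snk_poly t n.+1 =
  (-1) ^+ n * (t * \sum_(k < n.+1)
    (-1) ^+ k * ('C(n./2, k./2) * 'C(uphalf n, uphalf k))%:R * t ^+ k).
Proof.
rewrite /snk_poly big_add1 big_mkord !mulr_sumr; apply: eq_bigr => k _.
rewrite subSS signrB ?leq_ord // /snk !subn1 /= exprS; ring.
Qed.

Lemma snk_poly_odd (R : comNzRingType) (t : R) m :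
  snk_poly t m.*2.+1 = t * wpoly t m 0.
Proof.
rewrite snk_polyE signr_double mul1r doubleK uphalf_double /wpoly addn0.
(* The pairing needs an even number of terms; the extra one, at k = 2m+1, vanishes since C(m, m+1) =
   0. *)
rewrite -alternating_binconv doubleS [X in _ = _ * X]big_ord_recr /=.
by rewrite uphalf_double doubleK (@bin_small m m.+1) // muln0 mulr0 mul0r addr0.
Qed.

Lemma snk_poly_even (R : comNzRingType) (t : R) m :
  snk_poly t m.*2.+2 = t * ((t - 1) * wpoly t m 0).
Proof.
rewrite snk_polyE exprS signr_double mulr1 /= uphalf_double doubleK.
rewrite -doubleS alternating_binconv /wpoly addn0 binconvSr binconv_sym; ring.
Qed.

(** * Evaluation of the signed sums and conclusion *)

Lemma weighted_sum_odd (R : comNzRingType) (t : R) m :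
  weighted_sum t m.*2.+1 (fun=> 1) = t * wpoly t m 0.
Proof. by rewrite weighted_sum_iter; case: (iter_step t m). Qed.

Lemma weighted_sum_even (R : comNzRingType) (t : R) m :
  weighted_sum t m.*2.+2 (fun=> 1) = t * ((t - 1) * wpoly t m 0).
Proof. by rewrite weighted_sum_iter; case: (iter_step t m). Qed.

Lemma signed_sumE n :
  \sum_(s : 'S_n | avoids321 s) (-1) ^+ ninv s * 'X^(nlrm s) =
  weighted_sum ('X : {poly int}) n (fun=> 1).
Proof. by apply: eq_bigr => s _; rewrite mulr1. Qed.

Lemma horner_invpoly n : (invpoly n).[-1] =
  \sum_(s : 'S_n | avoids321 s) (-1) ^+ ninv s * 'X^(nlrm s).
Proof.
by rewrite /invpoly horner_sum; apply: eq_bigr => s _; rewrite hornerM hornerXn hornerC.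
Qed.

Lemma horner_invpoly_odd m :
  (invpoly m.*2.+1).[-1] = 'X * wpoly 'X m 0.
Proof. by rewrite horner_invpoly signed_sumE weighted_sum_odd. Qed.

Theorem theorem3p4 (n : nat) (hn : (1 <= n)%N) :
  [/\ (invpoly n).[-1] =
        \sum_(s : 'S_n | avoids321 s) (-1) ^+ ninv s * 'X^(nlrm s),
      \sum_(s : 'S_n | avoids321 s) (-1) ^+ ninv s * 'X^(nlrm s) =
        \sum_(1 <= k < n.+1) (-1) ^+ (n - k) * (snk n k)%:R * 'X^k
          :> {poly int},
      (invpoly (2 * n)).[-1] = ('X - 1) * (invpoly (2 * n - 1)).[-1] &
      (n%:R + 1) * (invpoly (2 * n + 1)).[-1] =
        2%:R * ((1 + 'X^2) * n%:R - 'X) * (invpoly (2 * n - 1)).[-1]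
        - (1 - 'X^2) ^+ 2 * (n%:R - 1) * (invpoly (2 * n - 3)).[-1]].
Proof.
split; first exact: horner_invpoly.
- rewrite signed_sumE -/(snk_poly 'X n).
  case: n hn => // n _; have := odd_double_half n; case: odd => <-.
    by rewrite weighted_sum_even snk_poly_even.
  by rewrite weighted_sum_odd snk_poly_odd.
- case: n hn => // m _; rewrite mul2n doubleS subn1 /= horner_invpoly_odd.
  by rewrite horner_invpoly signed_sumE weighted_sum_even; ring.
case: n hn => // m _; rewrite mul2n addn1 (horner_invpoly_odd m.+1) doubleS subn1 /=.
rewrite (horner_invpoly_odd m); case: m => [|m].
  (* For [n = 1] the truncated index [2 * n - 3] is 0, and the factor [n%:R - 1] cancels that
     term. *)
  by rewrite wpolyS0 !wpoly0; ring.
rewrite doubleS !subSS subn0 (horner_invpoly_odd m).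
have := wpoly0_recurrence ('X : {poly int}) m.
set a := wpoly _ _ _; set b := wpoly _ _ _; set c := wpoly _ _ _ => e.
rewrite natr1 mulrCA e; ring.
Qed.
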